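(* Let $q$ be a prime power, $a\in \mathrm{GF}(q^2)$ with $a\neq 0$, and $b\in \mathrm{GF}(q^2)\setminus \mathrm{GF}(q)$. Let $$\mathcal U_b=\{(1,x,bx^{q+1}+r)\mid x\in\mathrm{GF}(q^2),\ r\in\mathrm{GF}(q)\}\cup\{Y_\infty\},$$ a classical unital in $\mathrm{PG}(2,q^2)$. If $(a,b)$ satisfies Ebert's discriminant condition, then $\mathcal U_b$, regarded as a set of points of the projective closure of the affine plane $\mathfrak A_a$, is the non-classical B-M unital $U_{-a,b}$; that is, in the coordinates $(\xi,\eta)$ of $\mathfrak A_a$ it is the set $$\{(1,\xi,-a\xi^2+b\xi^{q+1}+r)\mid \xi\in\mathrm{GF}(q^2),\ r\in\mathrm{GF}(q)\}\cup\{Y_\infty\},$$ and this is a non-classical B-M unital in the projective closure of $\mathfrak A_a$. Conversely, every non-classical B-M unital of $\mathrm{PG}(2,q^2)$ which is not of H-Sz type is obtained in this way: for every such unital $V$ there are $a\in\mathrm{GF}(q^2)\setminus\{0\}$ and $b\in\mathrm{GF}(q^2)\setminus\mathrm{GF}(q)$ satisfying Ebert's discriminant condition and an isomorphism from the projective closure of $\mathfrak A_a$ onto $\mathrm{PG}(2,q^2)$ mapping $\mathcal U_b$ onto $V$.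
   Context: Coordinates: $\mathrm{PG}(2,q^2)$ has homogeneous coordinates $(x_0,x_1,x_2)$; $\mathrm{AG}(2,q^2)$ is the affine plane obtained by deleting the line $x_0=0$, with affine coordinates $x=x_1/x_0$, $y=x_2/x_0$; $Y_\infty=(0,0,1)$ is the infinite point of the vertical lines $x=k$. The plane $\mathfrak A_a$ ($a\neq 0$): its points are the points of $\mathrm{AG}(2,q^2)$; its lines are the vertical lines $x=k$ and the parabolas $y=ax^2+mx+d$, with $k,m,d\in\mathrm{GF}(q^2)$. It is an affine plane isomorphic to $\mathrm{AG}(2,q^2)$. A point of $\mathfrak A_a$ has $\mathfrak A_a$-coordinates $(\xi,\eta)$ when, as a point of $\mathrm{AG}(2,q^2)$, it has coordinates $x=\xi$, $y=\eta+a\xi^2$; in these coordinates the lines of $\mathfrak A_a$ are $\xi=k$ and $\eta=m\xi+d$. The projective closure of $\mathfrak A_a$ is obtained by adding its points at infinity in the usual way, and is identified with a copy of $\mathrm{PG}(2,q^2)$ in which the affine point $(\xi,\eta)$ has homogeneous coordinates $(1,\xi,\eta)$; the infinite point of the vertical lines of $\mathfrak A_a$ is identified with $Y_\infty$. A unital in (a copy of) $\mathrm{PG}(2,q^2)$ is a set of $q^3+1$ points met by every line in either $1$ or $q+1$ points. It is classical if it is the set of absolute points of a non-degenerate unitary polarity, i.e. the point set of a non-degenerate Hermitian curve. For $a,b\in\mathrm{GF}(q^2)$, $U_{a,b}=\{(1,x,ax^2+bx^{q+1}+r)\mid x\in\mathrm{GF}(q^2),\ r\in\mathrm{GF}(q)\}\cup\{Y_\infty\}$.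 Ebert's discriminant condition on $(a,b)$ is: for $q$ odd, $4a^{q+1}+(b^q-b)^2$ is a non-square in $\mathrm{GF}(q)$; for $q$ even, $b\notin\mathrm{GF}(q)$ and $\mathrm{Tr}\big(a^{q+1}/(b^q+b)^2\big)=0$, where $\mathrm{Tr}:\mathrm{GF}(q)\to\mathrm{GF}(2)$ is the trace. The B-M (Buekenhout–Metz) unitals of $\mathrm{PG}(2,q^2)$ are, up to projective equivalence, exactly the sets $U_{a,b}$ with $(a,b)$ satisfying Ebert's discriminant condition (this known characterization may be taken as the definition). $U_{a,b}$ is classical if and only if $a=0$. A B-M unital is of H-Sz (Hirschfeld–Szőnyi) type if $q$ is odd and it is the union of $q$ conics sharing a point; for $U_{a,b}$ this is equivalent to $q$ odd, $b\in\mathrm{GF}(q)$ and $a^{(q+1)/2}\in\mathrm{GF}(q^2)\setminus\mathrm{GF}(q)$. *)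

(* Defs.v *)
From HB Require Import structures.
From mathcomp Require Import all_boot all_order all_algebra.
Set Implicit Arguments.
Unset Strict Implicit.
Unset Printing Implicit Defensive.
Import GRing.Theory.
Local Open Scope ring_scope.

Definition prime_power (q : nat) : Prop :=
  exists p k : nat, [/\ prime p, (0 < k)%N & q = (p ^ k)%N].

(* Throughout, #|F| = q ^ 2, so that the fixed points of x |-> x ^ q form the
   subfield of order q. *)
Definition GFq (q : nat) (F : finFieldType) : {set F} :=
  [set x : F | x ^+ q == x].

(** Point-line geometries *)

Record geometry := Geometry {
  carrier :> finType;
  points : {set carrier};
  lines : {set {set carrier}}
}.

Definition isomorphism (G H : geometry) (f : G -> H) : Prop :=
  [/\ {in points G &, injective f},
      f @: points G = points H &
      [set f @: L | L : {set G} in lines G] = lines H].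

Definition unital (q : nat) (G : geometry) (V : {set G}) : Prop :=
  [/\ V \subset points G,
      #|V| = (q ^ 3 + 1)%N &
      forall L : {set G}, L \in lines G ->
        #|V :&: L| = 1%N \/ #|V :&: L| = q.+1].

Definition parallel_class (G : geometry) (L : {set G}) : {set {set G}} :=
  [set M in lines G | (M == L) || [disjoint M & L]].

(* The points at infinity are the parallel classes [inr c]. *)
Definition closure_lines (G : geometry) : {set {set (G + {set {set G}})}} :=
  [set inr @: [set parallel_class L | L : {set G} in lines G]]
  :|: [set inr (parallel_class L) |: inl @: L | L : {set G} in lines G].

Definition projective_closure (G : geometry) : geometry :=
  @Geometry (G + {set {set G}})%type
    (inl @: points G
     :|: inr @: [set parallel_class L | L : {set G} in lines G])
    (closure_lines G).

(** The projective plane over F *)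

(* A point is a one-dimensional subspace of F^3, represented by the set of its
   vectors. *)
Definition span1 (F : finFieldType) (v : 'rV[F]_3) : {set 'rV[F]_3} :=
  [set c *: v | c : F].

Definition pt (F : finFieldType) (x0 x1 x2 : F) : {set 'rV[F]_3} :=
  span1 (\row_(i < 3) [:: x0; x1; x2]`_i).

Definition PG_points (F : finFieldType) : {set {set 'rV[F]_3}} :=
  [set span1 v | v : 'rV[F]_3 & v != 0].

Definition PG_line (F : finFieldType) (u : 'rV[F]_3) : {set {set 'rV[F]_3}} :=
  [set P in PG_points F | [forall v in P, v *m u^T == 0]].

Definition PG (F : finFieldType) : geometry :=
  @Geometry {set 'rV[F]_3} (PG_points F)
    [set PG_line u | u : 'rV[F]_3 & u != 0].

Definition Yinf (F : finFieldType) : PG F := pt 0 0 1.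

Definition projectivity (F : finFieldType) (M : 'M[F]_3) (P : PG F) : PG F :=
  [set v *m M | v : 'rV[F]_3 in (P : {set 'rV[F]_3})].

Definition conjmx (q : nat) (F : finFieldType) (m n : nat) (A : 'M[F]_(m, n)) :
  'M[F]_(m, n) := map_mx (fun x : F => x ^+ q) A.

Definition hermitian_curve (q : nat) (F : finFieldType) (H : 'M[F]_3) :
  {set PG F} :=
  [set P in PG_points F | [forall v in P, v *m H *m (conjmx q v)^T == 0]].

Definition classical (q : nat) (F : finFieldType) (V : {set PG F}) : Prop :=
  exists H : 'M[F]_3,
    [/\ (conjmx q H)^T = H, H \in unitmx & V = hermitian_curve q H].

(* Symmetric matrices describe the non-degenerate conics only in odd
   characteristic, the only case in which [conic] is used. *)
Definition conic (F : finFieldType) (C : {set PG F}) : Prop :=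
  exists A : 'M[F]_3,
    [/\ A^T = A, A \in unitmx &
        C = [set P in PG_points F | [forall v in P, v *m A *m v^T == 0]]].

(** Buekenhout-Metz unitals *)

Definition Uab (q : nat) (F : finFieldType) (a b : F) : {set PG F} :=
  Yinf F |: [set (pt 1 x (a * x ^+ 2 + b * x ^+ q.+1 + r) : PG F)
            | x in [set: F], r in GFq q F].

Definition Ub (q : nat) (F : finFieldType) (b : F) : {set PG F} :=
  Yinf F |: [set (pt 1 x (b * x ^+ q.+1 + r) : PG F)
            | x in [set: F], r in GFq q F].

(* The absolute trace of GF(q), for q a power of 2. *)
Definition trace2 (q : nat) (F : finFieldType) (z : F) : F :=
  \sum_(i < logn 2 q) z ^+ (2 ^ i).

Definition ebert (q : nat) (F : finFieldType) (a b : F) : bool :=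
  if odd q then
    [forall s in GFq q F, s ^+ 2 != 4%:R * a ^+ q.+1 + (b ^+ q - b) ^+ 2]
  else
    (b \notin GFq q F) && (trace2 q (a ^+ q.+1 / (b ^+ q + b) ^+ 2) == 0).

Definition BM_unital (q : nat) (F : finFieldType) (V : {set PG F}) : Prop :=
  unital q V /\
  exists a b : F, ebert q a b /\
    exists2 M : 'M[F]_3, M \in unitmx & V = projectivity M @: Uab q a b.

Definition HSz_type (q : nat) (F : finFieldType) (V : {set PG F}) : Prop :=
  odd q /\
  exists (C : {set {set PG F}}) (P : PG F),
    [/\ #|C| = q,
        forall c : {set PG F}, c \in C -> conic c /\ P \in c &
        V = cover C].

(** The affine plane of vertical lines and translates of y = a x^2 + m x *)

Definition vline (F : finFieldType) (k : F) : {set F * F} :=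
  [set z : F * F | z.1 == k].

Definition parabola (F : finFieldType) (a m d : F) : {set F * F} :=
  [set z : F * F | z.2 == a * z.1 ^+ 2 + m * z.1 + d].

Definition Aplane (F : finFieldType) (a : F) : geometry :=
  @Geometry (F * F)%type [set: F * F]
    ([set vline k | k : F] :|: [set parabola a md.1 md.2 | md : F * F]).

Definition vclass (F : finFieldType) (a : F) : {set {set Aplane a}} :=
  @parallel_class (Aplane a) (vline 0).

Definition pclass (F : finFieldType) (a m : F) : {set {set Aplane a}} :=
  @parallel_class (Aplane a) (parabola a m 0).

(* A set V of affine points and possibly Yinf, as a set of points of the
   projective closure of [Aplane a], whose affine points are those of
   AG(2, F) and whose vertical infinite point is Yinf. *)
Definition in_closure (F : finFieldType) (a : F) (V : {set PG F}) :
  {set projective_closure (Aplane a)} :=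
  [set P in points (projective_closure (Aplane a)) |
     match P with
     | inl z => (pt 1 z.1 z.2 : PG F) \in V
     | inr c => (c == vclass a) && (Yinf F \in V)
     end].

(* Homogeneous coordinates on the projective closure of [Aplane a]: the affine
   point (x, y) has coordinates (xi, eta) = (x, y - a x^2), the infinite point
   of the lines eta = m xi + d is (0, 1, m), that of the vertical lines is
   (0, 0, 1). *)
Definition coordinates (F : finFieldType) (a : F)
    (P : projective_closure (Aplane a)) : PG F :=
  match P with
  | inl z => pt 1 z.1 (z.2 - a * z.1 ^+ 2)
  | inr c => if [pick m | c == pclass a m] is Some m then pt 0 1 m
             else Yinf F
  end.

(* Main.v *)
From mathcomp Require Import all_boot all_order all_algebra finfield.
From mathcomp Require Import ring zify.
Require Import Defs.
Set Implicit Arguments.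
Unset Strict Implicit.
Unset Printing Implicit Defensive.
Import GRing.Theory.
Local Open Scope ring_scope.

(** Taking xi = x and eta = y - a x ^ 2 as coordinates turns the vertical lines
and the parabolas y = a x ^ 2 + m x + d into the lines xi = k and
eta = m xi + d, so it extends to an isomorphism from the projective closure of
the plane of parabolas onto PG(2, q ^ 2) ([coordinates_iso]).  It sends the
point (x, b x ^ (q + 1) + r) of U_b to
(xi, - a xi ^ 2 + b xi ^ (q + 1) + r), hence U_b onto U_{-a,b}
([coordinates_in_closure]).  What remains are facts on the sets U_{a,b}, where
e stands for b ^ q - b.

Ebert's condition says that mu ^ 2 - e mu = a ^ (q + 1) has two distinct roots
with mu ^ q = - mu ([ebert_root]); this uses square roots for q odd and
Artin-Schreier theory for q even.  Given such a root mu <> 0, the GF(q)-linear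
bijection phi x = - (a / mu) x + x ^ q satisfies
f ^ q - f = mu (phi x) ^ (q + 1) for f = a x ^ 2 + b x ^ (q + 1).  The affine
points of U_{a,b} on a non-vertical line therefore correspond, after a
translation, to a fibre of the norm, which has 1 or q + 1 elements
([card_quadric]).  So U_{a,b} is a unital ([Uab_unital]).

U_b = U_{0,b} is the Hermitian curve e (y ^ q - y) = e ^ 2 x ^ (q + 1)
([Uab0_classical]).  If a <> 0, b is not in GF(q) and Ebert's condition holds,
then q > 2 ([ebert_q_gt2]), and comparing U_{a,b} with the general Hermitian
equation shows that it is not classical ([Uab_nonclassical]).

For the converse, a unital equivalent to U_{a,b} with b in GF(q) is of
Hirschfeld-Szonyi type, because U_{a,b} is then the union of the q conics
y = a x ^ 2 + r ([Uab_HSz]), and one with a = 0 is classical.  In the remaining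
cases U_{a,b} is the image of U_b under the coordinates of the plane with
parameter - a, and composing with a projectivity gives every unital equivalent
to it. *)

(** * Polynomials splitting over a finite field *)

Section RootCount.
Variable F : finFieldType.
Implicit Types p : {poly F}.

Lemma card_roots_le p : p != 0 -> (#|[set x | root p x]| <= (size p).-1)%N.
Proof.
move=> p0; rewrite -ltnS prednK ?size_poly_gt0 // cardE.
apply: max_poly_roots => //; last exact: enum_uniq.
by apply/allP => x; rewrite mem_enum inE.
Qed.

(** A divisor of 'X^#|F| - 'X splits with simple roots: every element of F is a
root of it or of its cofactor, and neither can have more roots than its
degree. *)
Lemma card_roots_dvdp p :
  p %| 'X^#|F| - 'X -> #|[set x | root p x]| = (size p).-1.
Proof.
have F1 := finNzRing_gt1 F.
have sG : size ('X^#|F| - 'X : {poly F}) = #|F|.+1.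
  by rewrite size_polyDl ?size_polyXn // size_polyN size_polyX.
have G0 : ('X^#|F| - 'X : {poly F}) != 0 by rewrite -size_poly_gt0 sG.
move=> /dvdpP[r Er].
have r0 : r != 0 by apply: contraNneq G0 => r0; rewrite Er r0 mul0r.
have p0 : p != 0 by apply: contraNneq G0 => p0; rewrite Er p0 mulr0.
have /eqP := sG; rewrite Er size_mul // => /eqP sz.
have cover_roots : (#|F| <= #|[set x | root p x]| + #|[set x | root r x]|)%N.
  rewrite -cardsT -cardsUI (leq_trans _ (leq_addr _ _)) // subset_leq_card //.
  apply/subsetP => x _; rewrite !inE.
  have : root (r * p) x by rewrite -Er rootE !hornerE expf_card subrr.
  by rewrite rootM orbC.
apply/eqP; rewrite eqn_leq card_roots_le //=.
have := card_roots_le r0; move: cover_roots sz p0 r0.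
rewrite -!size_poly_gt0; move: #|_| #|_| => m n.
move: #|F| (size p) (size r) => N sp sr.
lia.
Qed.

End RootCount.

(** * The subfield GF(q) of GF(q^2) *)

Section Subfield.
Variables (q : nat) (F : finFieldType).
Hypotheses (hq : prime_power q) (hF : #|F| = (q ^ 2)%N).
Implicit Types x y c d w : F.

Lemma pchar_pnat : [pchar F].-nat q.
Proof.
have [p [k [pr_p k0 qE]]] := hq.
have chF : p \in [pchar F].
  by apply: (@card_finPcharP F p (k * 2)) => //; rewrite hF qE expnM.
by rewrite qE pnatX; apply/orP; left; rewrite pnatE.
Qed.

Lemma q_gt1 : (1 < q)%N.
Proof.
have [p [k [pr_p k0 ->]]] := hq.
by rewrite -{1}(expn0 p) ltn_exp2l ?prime_gt1.
Qed.

Lemma frobD x y : (x + y) ^+ q = x ^+ q + y ^+ q.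
Proof. exact: exprDn_pchar pchar_pnat. Qed.

Lemma frob0 : 0 ^+ q = 0 :> F.
Proof. by rewrite expr0n gtn_eqF // ltnW // q_gt1. Qed.

Lemma frobN x : (- x) ^+ q = - x ^+ q.
Proof.
by apply/eqP; rewrite -addr_eq0 -frobD addNr frob0.
Qed.

Lemma frobB x y : (x - y) ^+ q = x ^+ q - y ^+ q.
Proof. by rewrite frobD frobN. Qed.

Lemma frobK x : (x ^+ q) ^+ q = x.
Proof. by rewrite -exprM mulnn -hF expf_card. Qed.

Lemma GFqE x : (x \in GFq q F) = (x ^+ q == x).
Proof. by rewrite inE. Qed.

Lemma GFqD x y : x \in GFq q F -> y \in GFq q F -> x + y \in GFq q F.
Proof. by rewrite !GFqE frobD => /eqP-> /eqP->. Qed.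

Lemma GFqN x : (- x \in GFq q F) = (x \in GFq q F).
Proof. by rewrite !GFqE frobN eqr_opp. Qed.

Lemma GFqM x y : x \in GFq q F -> y \in GFq q F -> x * y \in GFq q F.
Proof. by rewrite !GFqE exprMn => /eqP-> /eqP->. Qed.

Lemma frob_norm x : (x ^+ q.+1) ^+ q = x ^+ q.+1.
Proof. by rewrite exprS exprMn frobK mulrC. Qed.

Lemma norm_GFq x : x ^+ q.+1 \in GFq q F.
Proof. by rewrite GFqE frob_norm. Qed.

Lemma Xq_dvdp : 'X^q - 'X %| ('X^#|F| - 'X : {poly F}).
Proof.
have chP : [pchar {poly F}].-nat q.
  by rewrite (eq_pnat _ (pchar_poly F)) pchar_pnat.
have -> : 'X^#|F| - 'X = ('X^q - 'X) ^+ q + ('X^q - 'X) :> {poly F}.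
  rewrite exprDn_pchar // -exprM mulnn -hF.
  have -> : (- 'X) ^+ q = - 'X^q :> {poly F}.
    apply/eqP; rewrite -addr_eq0 -exprDn_pchar // addNr expr0n.
    by rewrite gtn_eqF // ltnW // q_gt1.
  by rewrite addrA addrNK.
rewrite dvdp_addr // -[X in X %| _]expr1; apply: dvdp_exp2l.
exact: ltnW q_gt1.
Qed.

Lemma card_GFq : #|GFq q F| = q.
Proof.
have -> : GFq q F = [set x | root ('X^q - 'X) x].
  by apply/setP => x; rewrite !inE rootE !hornerE subr_eq0.
rewrite card_roots_dvdp ?Xq_dvdp //.
by rewrite size_polyDl ?size_polyXn // size_polyN size_polyX ltnS q_gt1.
Qed.

(** The pure equation 'X^n = c has n roots in F as soon as n divides #|F| - 1
and c is an m-th root of unity for the complementary divisor m. *)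
Lemma card_pure_roots n m c : (0 < n)%N -> (n * m)%N = #|F|.-1 -> c ^+ m = 1 ->
  #|[set x | x ^+ n == c]| = n.
Proof.
move=> n0 nm cm.
have -> : [set x | x ^+ n == c] = [set x | root ('X^n - c%:P) x].
  by apply/setP => x; rewrite !inE rootE !hornerE subr_eq0.
rewrite card_roots_dvdp ?size_XnsubC //.
have -> : 'X^#|F| - 'X = 'X * (('X^n) ^+ m - c%:P ^+ m) :> {poly F}.
  rewrite -rmorphXn /= cm -exprM nm mulrBr mulr1 -exprS prednK //.
  exact: ltnW (finNzRing_gt1 F).
by rewrite subrXX dvdp_mull // dvdp_mulr.
Qed.

Lemma pchar2_even : ~~ odd q -> 2%N \in [pchar F].
Proof.
have [p [k [pr_p k0 qE]]] := hq => eq.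
suff p2 : p = 2%N.
  by apply: (@card_finPcharP F 2 (k * 2)) => //; rewrite hF qE p2 expnM.
by apply/eqP; move: eq; rewrite qE oddX negb_or -lt0n k0 /= => /(prime_oddPn pr_p)->.
Qed.

Lemma even_pow2 : ~~ odd q -> q = (2 ^ logn 2 q)%N.
Proof.
move=> /pchar2_even ch2; rewrite -p_part part_pnat_id //.
by rewrite -(eq_pnat _ (pcharf_eq ch2)) pchar_pnat.
Qed.

Lemma two_neq0_odd : odd q -> 2%:R != 0 :> F.
Proof.
rewrite odd_2'nat => q2'; apply/negP => F2.
have ch2 : 2%N \in [pchar F] by rewrite inE.
have q2 : (2%N).-nat q by rewrite -(eq_pnat _ (pcharf_eq ch2)) pchar_pnat.
by have := q_gt1; rewrite (pnat_1 q2 q2').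
Qed.

Lemma GFq_expS c : c \in GFq q F -> c != 0 -> c ^+ q.-1 = 1.
Proof.
rewrite GFqE => /eqP cq c0; apply: (mulfI c0).
by rewrite -exprS prednK ?cq ?mulr1 // ltnW // q_gt1.
Qed.

Lemma card_norm_fiber c : c \in GFq q F -> c != 0 ->
  #|[set x | x ^+ q.+1 == c]| = q.+1.
Proof.
move=> cq c0; apply: (@card_pure_roots _ q.-1) => //; last exact: GFq_expS.
by rewrite hF; move: q_gt1; case: q => // k _ /=; lia.
Qed.

Lemma card_norm_fiber0 : #|[set x : F | x ^+ q.+1 == 0]| = 1%N.
Proof.
rewrite -(cards1 (0 : F)); apply: eq_card => x.
by rewrite !inE expf_eq0.
Qed.

Lemma GFq_sqrt d : odd q -> d \in GFq q F -> d != 0 -> exists s, s ^+ 2 = d.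
Proof.
move=> oq dq d0.
have qS : q.+1 = (q.+1./2).*2 by rewrite -[LHS]odd_double_half /= oq.
have : (0 < #|[set x : F | x ^+ 2 == d]|)%N.
  rewrite (@card_pure_roots _ (q.-1 * q.+1./2)) //.
    by rewrite hF; move: qS q_gt1; case: q => // k /=; lia.
  by rewrite exprM GFq_expS // expr1n.
by case/card_gt0P=> s; rewrite inE => /eqP; exists s.
Qed.

(** Artin-Schreier: the composite of the trace polynomial with 'X^2 + 'X is
'X^q - 'X, so 'X^2 + 'X - w divides 'X^q - 'X when w has trace zero. *)
Lemma GFq_artin_schreier w : ~~ odd q -> trace2 q w = 0 ->
  exists2 v, v \in GFq q F & v ^+ 2 + v = w.
Proof.
move=> eq tw.
set k := logn 2 q; have qE : q = (2 ^ k)%N := even_pow2 eq.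
have ch2 : 2 \in [pchar {poly F}] by rewrite pchar_poly pchar2_even.
pose T : {poly F} := \sum_(i < k) 'X^(2 ^ i).
have Tw : 'X - w%:P %| T.
  have TE : T.[w] = trace2 q w.
    rewrite horner_sum /trace2.
    by apply: eq_bigr => i _; rewrite hornerXn.
  by rewrite dvdp_XsubCl rootE TE tw.
have TX : T \Po ('X^2 + 'X) = 'X^q - 'X.
  rewrite rmorph_sum /= (eq_bigr (fun i : 'I_k => 'X^(2 ^ i.+1) - 'X^(2 ^ i))).
    rewrite -(big_mkord xpredT (fun i => 'X^(2 ^ i.+1) - 'X^(2 ^ i))).
    by rewrite telescope_sumr // qE expn0.
  move=> i _; rewrite rmorphXn /= comp_polyX exprDn_pchar.
    by rewrite -exprM -expnS (oppr_pchar2 ch2).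
  by rewrite pnatX pnatE // ch2.
have dv : 'X^2 + 'X - w%:P %| 'X^q - 'X.
  case/dvdpP: Tw => S TS; rewrite -TX TS comp_polyM dvdp_mull //.
  by rewrite comp_polyB comp_polyX comp_polyC.
have : (0 < #|[set x : F | root ('X^2 + 'X - w%:P) x]|)%N.
  rewrite card_roots_dvdp; last exact: dvdp_trans dv Xq_dvdp.
  rewrite -addrA size_polyDl ?size_polyXn //.
  by rewrite size_polyDl ?size_polyX // size_polyN (leq_ltn_trans (size_polyC_leq1 _)).
case/card_gt0P=> v; rewrite inE => rv; exists v.
  case/dvdpP: dv => S ES; have : root ('X^q - 'X) v by rewrite ES rootM rv orbT.
  by rewrite rootE !hornerE subr_eq0 GFqE.
by move: rv; rewrite rootE !hornerE subr_eq0 => /eqP.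
Qed.

End Subfield.

(** * Ebert's condition *)

Section Ebert.
Variables (q : nat) (F : finFieldType).
Hypotheses (hq : prime_power q) (hF : #|F| = (q ^ 2)%N).
Implicit Types a b m d x : F.
Let frobD := frobD hq hF.
Let frobN := frobN hq hF.
Let frobB := frobB hq hF.
Let frobK := frobK hF.

(** Both forms of Ebert's condition say that the quadratic equation
mu ^ 2 - (b ^ q - b) mu = a ^ (q + 1) has distinct roots with mu ^ q = - mu. *)
Lemma ebert_root a b : ebert q a b ->
  exists mu, [/\ mu != 0, mu ^+ q = - mu,
    mu ^+ 2 - (b ^+ q - b) * mu = a ^+ q.+1 & mu *+ 2 != b ^+ q - b].
Proof.
set e := b ^+ q - b => eab.
have eq : e ^+ q = - e by rewrite /e frobB frobK opprB.
suff [m [mq mE m2]] : exists m, [/\ m ^+ q = - m,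
    m ^+ 2 - e * m = a ^+ q.+1 & m *+ 2 != e].
  have [m0|m0] := eqVneq m 0; last by exists m.
  (* m = 0 forces a = 0, and e is the other root *)
  exists (e - m); split; rewrite ?(frobB e m) ?eq ?mq -?mE.
  - by rewrite m0 subr0 eq_sym; move: m2; rewrite m0 mul0rn.
  - by ring.
  - by ring.
  by move: m2; rewrite m0 mul0rn eq_sym subr0 mulr2n -(subr_eq0 (e + e)) addrK.
move: eab; rewrite /ebert; case: ifP => [oq|/negbT oq].
  move=> /forallP nsq; set D := 4%:R * _ + _ in nsq.
  have F2 : 2%:R != 0 :> F := two_neq0_odd hq hF oq.
  have Dq : D \in GFq q F.
    rewrite /D -/e GFqE frobD -exprM mulnC exprM eq sqrrN.
    have := norm_GFq hF a; rewrite GFqE; set n := a ^+ q.+1 => /eqP nq.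
    by rewrite (_ : 4%:R * n = n + n + n + n); [rewrite !frobD nq | ring].
  have D0 : D != 0.
    by have := nsq 0; rewrite GFqE !expr0n gtn_eqF ?(ltnW (q_gt1 hq)) // eqxx eq_sym.
  have [s sD] := GFq_sqrt hq hF oq Dq D0.
  have sq : s ^+ q = - s.
    have := nsq s; rewrite sD eqxx GFqE implybF => /negPf sq.
    have /eqP : (s ^+ q) ^+ 2 = s ^+ 2.
      by rewrite -exprM mulnC exprM sD; move: Dq; rewrite GFqE => /eqP.
    by rewrite eqf_sqr sq => /eqP.
  have s0 : s != 0 by apply: contraNneq D0 => s0; rewrite -sD s0 expr0n.
  have q2 : 2%:R ^+ q = 2%:R :> F by rewrite (_ : 2%:R = 1 + 1) // frobD expr1n.
  exists ((e + s) / 2%:R); split.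
  - by rewrite exprMn exprVn frobD eq sq q2 -opprD mulNr.
  - have -> : a ^+ q.+1 = (s ^+ 2 - e ^+ 2) / 4%:R.
      rewrite sD /D -/e addrK mulrC mulKf //.
      by rewrite (_ : 4%:R = 2%:R * 2%:R) ?mulf_neq0 // -natrM.
    field.
    by rewrite F2 (_ : 4%:R = 2%:R * 2%:R) ?mulf_neq0 // -natrM.
  by rewrite -[_ *+ 2]mulr_natr mulfVK // -subr_eq0 addrC addKr.
case/andP=> bq /eqP tr.
have ch2 := pchar2_even hq hF oq.
have e0 : e != 0 by rewrite subr_eq0 -GFqE.
have bE : b ^+ q + b = e by rewrite /e (oppr_pchar2 ch2).
rewrite bE in tr.
have [v vq vE] := GFq_artin_schreier hq hF oq tr.
exists (e * v); split.
- by rewrite exprMn eq mulNr; move: vq; rewrite GFqE => /eqP->.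
- rewrite (oppr_pchar2 ch2) (_ : _ + _ = e ^+ 2 * (v ^+ 2 + v)); last by ring.
  by rewrite vE mulrC mulfVK // expf_neq0.
by rewrite mulr2n addrr_pchar2 // eq_sym.
Qed.

(** With phi x = alpha x + x ^ q and alpha = - a / mu, one has
(a x ^ 2 + b x ^ (q + 1)) ^ q - (a x ^ 2 + b x ^ (q + 1)) = mu (phi x) ^ (q + 1);
a translation then absorbs the terms of degree at most one, and what is
counted is a fibre of the norm. *)
Lemma card_quadric a b m d : ebert q a b ->
  let S := [set x | a * x ^+ 2 + b * x ^+ q.+1 + (m * x + d) \in GFq q F] in
  #|S| = 1%N \/ #|S| = q.+1.
Proof.
case/ebert_root => mu [mu0 muq muE mu2] S.
pose al := - a / mu.
have alq : al ^+ q = a ^+ q / mu.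
  by rewrite /al exprMn frobN exprVn muq invrN mulrNN.
have Nal : al * al ^+ q != 1.
  apply: contra mu2 => /eqP al1; apply/eqP/(mulfI mu0).
  have : a * a ^+ q = - mu ^+ 2.
    rewrite -[RHS]mulr1 -al1 alq /al; field.
    by [].
  rewrite -exprS -muE => /eqP; rewrite subr_eq => /eqP E.
  by rewrite mulrC mulr2n mulrDl -!expr2 {1}E; ring.
have al_inj t : t = al * al ^+ q * t -> t = 0.
  move=> tE; apply/eqP; apply: contraR Nal => t0.
  by rewrite -(inj_eq (mulIf t0)) mul1r -tE.
pose phi x := al * x + x ^+ q.
have phi_inj : injective phi.
  move=> x y /eqP; rewrite -subr_eq0 => /eqP.
  have -> : phi x - phi y = al * (x - y) + (x - y) ^+ q.
    by rewrite /phi frobB; ring.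
  move/eqP; rewrite addrC addr_eq0 => /eqP tq.
  apply/eqP; rewrite -subr_eq0; apply/eqP; move: (x - y) tq => t tq.
  by apply: al_inj; rewrite -[LHS]frobK tq frobN exprMn tq; ring.
pose psi t := t ^+ q * al + t.
have psi_inj : injective psi.
  move=> x y /eqP; rewrite -subr_eq0 => /eqP.
  have -> : psi x - psi y = (x - y) ^+ q * al + (x - y).
    by rewrite /psi frobB; ring.
  move/eqP; rewrite addrC addr_eq0 => /eqP tq.
  apply/eqP; rewrite -subr_eq0; apply/eqP; move: (x - y) tq => t tq.
  by apply: al_inj; rewrite {1}tq {1}tq frobN exprMn frobK; ring.
(* z |-> z + tau completes the norm so as to absorb m x *)
pose tau := invF psi_inj (- m / mu).
have tauE : mu * (tau ^+ q * al + tau) = - m.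
  by rewrite -/(psi tau) f_invF mulrC mulfVK.
have tauqE : mu * (tau * al ^+ q + tau ^+ q) = m ^+ q.
  have := congr1 (fun z => z ^+ q) tauE.
  by rewrite frobN exprMn muq frobD exprMn frobK mulNr => /oppr_inj.
pose c := tau ^+ q.+1 - (d ^+ q - d) / mu.
have cq : c \in GFq q F.
  rewrite /c GFqD ?GFqN ?norm_GFq //.
  by rewrite GFqE exprMn exprVn muq frobB frobK invrN mulrN -mulNr opprB.
have -> : S = (fun x => phi x + tau) @^-1: [set y | y ^+ q.+1 == c].
  apply/setP => x; rewrite !inE -subr_eq0 -[RHS]subr_eq0.
  rewrite -[RHS](inj_eq (mulfI mu0)) mulr0; congr (_ == 0).
  have mual : mu * al = - a by rewrite /al mulrC mulfVK.
  have mualq : mu * al ^+ q = a ^+ q by rewrite alq mulrC mulfVK.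
  have muN : mu * (al * al ^+ q + 1) = b ^+ q - b.
    apply: (mulfI mu0); rewrite [RHS]mulrC.
    have -> : (b ^+ q - b) * mu = mu ^+ 2 - a * a ^+ q by rewrite -exprS -muE; ring.
    by rewrite -mualq -[a]opprK -mual; ring.
  have -> : mu * ((phi x + tau) ^+ q.+1 - c) =
      mu * al * x ^+ 2 + mu * al ^+ q * (x ^+ q) ^+ 2
      + mu * (al * al ^+ q + 1) * (x * x ^+ q)
      + (mu * (tau ^+ q * al + tau) * x
      + mu * (tau * al ^+ q + tau ^+ q) * x ^+ q) + (d ^+ q - d).
    rewrite /c !exprS /phi !(frobD, exprMn, frobK) mulrBr mulrBr.
    by rewrite [mu * (_ / mu)]mulrC mulfVK //; ring.
  rewrite mual mualq muN tauE tauqE [x ^+ q.+1]exprS !(frobD, exprMn, frobK).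
  ring.
rewrite card_preimset; last by move=> x y /addIr/phi_inj.
have [->|c0] := eqVneq c 0; first by left; exact: card_norm_fiber0.
by right; apply: card_norm_fiber.
Qed.

End Ebert.

(** * Points and lines of PG(2, F) *)

Section Plane.
Variable F : finFieldType.
Implicit Types (x y m : F) (v w : 'rV[F]_3).

(** The row vector (x0, x1, x2), so that pt x0 x1 x2 is the point it spans. *)
Definition vec3 (x0 x1 x2 : F) : 'rV[F]_3 := \row_(i < 3) [:: x0; x1; x2]`_i.

Lemma vec3P v : exists x0 x1 x2, v = vec3 x0 x1 x2.
Proof.
exists (v 0 0), (v 0 1), (v 0 2%:R); apply/rowP => i; rewrite mxE.
by case: i => [[|[|[|]]]] //= ?; congr (v _ _); apply: val_inj.
Qed.

Lemma vec3_inj x0 x1 x2 y0 y1 y2 :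
  vec3 x0 x1 x2 = vec3 y0 y1 y2 -> [/\ x0 = y0, x1 = y1 & x2 = y2].
Proof.
move/rowP => E; split.
- by have := E 0; rewrite !mxE.
- by have := E 1; rewrite !mxE.
by have := E 2%:R; rewrite !mxE.
Qed.

Lemma vec3Z c x0 x1 x2 : c *: vec3 x0 x1 x2 = vec3 (c * x0) (c * x1) (c * x2).
Proof. by apply/rowP => i; rewrite !mxE; case: i => [[|[|[|]]]]. Qed.

Lemma vec3_eq0 x0 x1 x2 : (vec3 x0 x1 x2 == 0) = [&& x0 == 0, x1 == 0 & x2 == 0].
Proof.
have E0 : 0 = vec3 0 0 0 by apply/rowP => i; rewrite !mxE; case: i => [[|[|[|]]]].
apply/eqP/and3P => [|[/eqP-> /eqP-> /eqP->]]; last by rewrite E0.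
by rewrite E0 => /vec3_inj[-> -> ->].
Qed.

Lemma mx11_eq0 (A : 'M[F]_1) : (A == 0) = (A 0 0 == 0).
Proof.
apply/eqP/eqP => [->|A0]; first by rewrite mxE.
by apply/matrixP => i j; rewrite !ord1 mxE.
Qed.

Lemma vec3_dot x0 x1 x2 u0 u1 u2 :
  (vec3 x0 x1 x2 *m (vec3 u0 u1 u2)^T == 0) = (x0 * u0 + x1 * u1 + x2 * u2 == 0).
Proof. by rewrite mx11_eq0 !mxE !big_ord_recr big_ord0 /= !mxE /= add0r. Qed.

Lemma mem_span1 v : v \in span1 v.
Proof. by apply/imsetP; exists 1; rewrite ?scale1r. Qed.

Lemma span1Z c v : c != 0 -> span1 (c *: v) = span1 v.
Proof.
move=> c0; apply/setP => w; apply/imsetP/imsetP => -[d _ ->].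
  by exists (d * c); rewrite ?scalerA.
by exists (d / c); rewrite ?scalerA ?mulfVK.
Qed.

Lemma span1_eqP v w : span1 v = span1 w -> exists c, v = c *: w.
Proof.
by move=> E; have := mem_span1 v; rewrite E => /imsetP[c _ ->]; exists c.
Qed.

Lemma ptZ c x0 x1 x2 : c != 0 -> pt (c * x0) (c * x1) (c * x2) = pt x0 x1 x2.
Proof. by move=> c0; rewrite -[RHS](span1Z _ c0) vec3Z. Qed.

Lemma pt1_inj x y x' y' : pt 1 x y = pt 1 x' y' -> x = x' /\ y = y'.
Proof.
case/span1_eqP => c; rewrite vec3Z => /vec3_inj[].
by rewrite mulr1 => <-; rewrite !mul1r.
Qed.

Lemma pt01_inj m m' : pt 0 1 m = pt 0 1 m' -> m = m'.
Proof.
case/span1_eqP => c; rewrite vec3Z => /vec3_inj[_].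
by rewrite mulr1 => <-; rewrite mul1r.
Qed.

Lemma pt1_neq_pt0 x y z t : pt 1 x y <> pt 0 z t.
Proof.
case/span1_eqP => c; rewrite vec3Z => /vec3_inj[/eqP].
by rewrite mulr0 oner_eq0.
Qed.

Lemma pt01_neq_Yinf m : pt 0 1 m <> pt 0 0 1.
Proof.
case/span1_eqP => c; rewrite vec3Z => /vec3_inj[_ /eqP].
by rewrite mulr0 oner_eq0.
Qed.

Lemma span1_PG v : v != 0 -> span1 v \in PG_points F.
Proof. by move=> v0; apply/imsetP; exists v; rewrite ?inE. Qed.

Lemma pt1_PG x y : pt 1 x y \in PG_points F.
Proof. by rewrite span1_PG // vec3_eq0 oner_eq0. Qed.

Lemma pt01_PG m : pt 0 1 m \in PG_points F.
Proof. by rewrite span1_PG // vec3_eq0 oner_eq0 andbF. Qed.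

Lemma Yinf_PG : pt 0 0 1 \in PG_points F.
Proof. by rewrite span1_PG // vec3_eq0 oner_eq0 !andbF. Qed.

(** Normal forms of the points: affine, infinite of slope m, infinite
vertical. *)
Variant PG_point_spec : {set 'rV[F]_3} -> Prop :=
  | PGaffine x y : PG_point_spec (pt 1 x y)
  | PGslope m : PG_point_spec (pt 0 1 m)
  | PGvertical : PG_point_spec (pt 0 0 1).

Lemma PG_pointP (P : {set 'rV[F]_3}) : P \in PG_points F -> PG_point_spec P.
Proof.
case/imsetP => v; rewrite inE; have [x0 [x1 [x2 ->]]] := vec3P v => v0 ->.
rewrite -[span1 _]/(pt x0 x1 x2).
have [x00|x0n] := eqVneq x0 0; last first.
  by rewrite -(ptZ _ _ _ (invr_neq0 x0n)) mulVf //; constructor.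
have [x10|x1n] := eqVneq x1 0; last first.
  by rewrite -(ptZ _ _ _ (invr_neq0 x1n)) mulVf // x00 mulr0; constructor.
have x2n : x2 != 0 by move: v0; rewrite vec3_eq0 x00 x10 eqxx.
by rewrite -(ptZ _ _ _ (invr_neq0 x2n)) mulVf // x00 x10 !mulr0; constructor.
Qed.

Lemma PG_line_sub (u : 'rV[F]_3) : PG_line u \subset PG_points F.
Proof. by apply/subsetP => P; rewrite inE => /andP[]. Qed.

Lemma span1_in_line v u : v != 0 ->
  (span1 v \in PG_line u) = (v *m u^T == 0).
Proof.
move=> v0; rewrite inE span1_PG //=; apply/forall_inP/idP => [|/eqP vu w].
  by apply; exact: mem_span1.
by case/imsetP => c _ ->; rewrite -scalemxAl vu scaler0.
Qed.

Lemma pt1_in_line x y u0 u1 u2 :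
  (pt 1 x y \in PG_line (vec3 u0 u1 u2)) = (u0 + x * u1 + y * u2 == 0).
Proof. by rewrite span1_in_line ?vec3_dot ?mul1r // vec3_eq0 oner_eq0. Qed.

Lemma pt01_in_line m u0 u1 u2 :
  (pt 0 1 m \in PG_line (vec3 u0 u1 u2)) = (u1 + m * u2 == 0).
Proof.
by rewrite span1_in_line ?vec3_dot ?mul0r ?mul1r ?add0r // vec3_eq0 oner_eq0 andbF.
Qed.

Lemma Yinf_in_line u0 u1 u2 :
  (pt 0 0 1 \in PG_line (vec3 u0 u1 u2)) = (u2 == 0).
Proof.
by rewrite span1_in_line ?vec3_dot ?mul0r ?mul1r ?add0r // vec3_eq0 oner_eq0 !andbF.
Qed.

End Plane.

(** * The unitals U_{a,b} *)

Section Uab.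
Variables (q : nat) (F : finFieldType).
Hypotheses (hq : prime_power q) (hF : #|F| = (q ^ 2)%N).
Implicit Types a b m d x y : F.

Lemma pt1_in_Uab a b x y :
  (pt 1 x y \in Uab q a b) = (y - (a * x ^+ 2 + b * x ^+ q.+1) \in GFq q F).
Proof.
apply/setU1P/idP => [[/pt1_neq_pt0//|/imset2P[x' r _ rq /pt1_inj[-> ->]]]|yq].
  by rewrite addrC addKr.
by right; apply/imset2P; exists x (y - (a * x ^+ 2 + b * x ^+ q.+1)); rewrite // subrKC.
Qed.

Lemma pt01_notin_Uab a b m : (pt 0 1 m \in Uab q a b) = false.
Proof.
apply/negP => /setU1P[/pt01_neq_Yinf//|/imset2P[x r _ _ /esym]].
exact: pt1_neq_pt0.
Qed.

Lemma Yinf_in_Uab a b : (pt 0 0 1 : PG F) \in Uab q a b.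
Proof. exact: setU11. Qed.

Lemma Uab_PG a b : Uab q a b \subset PG_points F.
Proof.
apply/subsetP => P /setU1P[->|/imset2P[x r _ _ ->]]; first exact: Yinf_PG.
exact: pt1_PG.
Qed.

Lemma card_Uab a b : #|Uab q a b| = (q ^ 3 + 1)%N.
Proof.
rewrite /Uab; set S := imset2 _ _ _.
have YS : Yinf F \notin S by apply/imset2P => -[x r _ _ /esym/pt1_neq_pt0].
rewrite cardsU1 YS /S curry_imset2X card_imset; last first.
  by move=> [x r] [x' r'] /= /pt1_inj[<- /addrI<-].
by rewrite cardsX cardsT hF (card_GFq hq hF) addnC -expnSr.
Qed.

(** The line u0 + u1 x + u2 y = 0 meets U_{a,b} in a norm fibre if u2 <> 0, in
the infinite point and a translate of GF(q) if u2 = 0 <> u1, and in the infinite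
point alone otherwise. *)
Lemma Uab_unital a b : ebert q a b -> unital q (Uab q a b).
Proof.
move=> eab; split; [exact: Uab_PG | exact: card_Uab | move=> L].
case/imsetP => u; rewrite inE.
have [u0 [u1 [u2 ->]]] := vec3P u => un0 -> {u L}.
have [u20|u2n] := eqVneq u2 0; last first.
  pose S := [set x | a * x ^+ 2 + b * x ^+ q.+1 + (u1 / u2 * x + u0 / u2) \in GFq q F].
  pose g x : PG F := pt 1 x (- (u0 + x * u1) / u2).
  suff -> : Uab q a b :&: PG_line (vec3 u0 u1 u2) = g @: S.
    rewrite card_imset; first exact: card_quadric.
    by move=> x x' /pt1_inj[].
  apply/setP => P; apply/setIP/imsetP => [[PU]|[x xS ->]].
    have PP := subsetP (Uab_PG a b) P PU; case/PG_pointP: PP PU => [x y|m|].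
    - rewrite pt1_in_Uab pt1_in_line addr_eq0 => xy /eqP E.
      have yE : y = - (u0 + x * u1) / u2 by rewrite E opprK mulfK.
      exists x; last by rewrite /g yE.
      rewrite inE -GFqN // (_ : - _ = y - (a * x ^+ 2 + b * x ^+ q.+1)) // yE.
      by field.
    - by rewrite pt01_notin_Uab.
    by rewrite Yinf_in_line (negPf u2n).
  rewrite pt1_in_Uab pt1_in_line mulfVK // subrr eqxx; split=> //.
  rewrite -GFqN // (_ : - _ = a * x ^+ 2 + b * x ^+ q.+1 + (u1 / u2 * x + u0 / u2)).
    by move: xS; rewrite inE.
  by field.
subst u2; have [u10|u1n] := eqVneq u1 0.
  left; subst u1; apply/eqP/cards1P; exists (Yinf F).
  have u00 : u0 != 0 by move: un0; rewrite vec3_eq0 eqxx !andbT.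
  apply/setP => P; rewrite in_set1; apply/setIP/eqP => [[PU]|->]; last first.
    by rewrite Yinf_in_Uab Yinf_in_line eqxx.
  have PP := subsetP (Uab_PG a b) P PU; case/PG_pointP: PP PU => [x y|m|//].
    by rewrite pt1_in_line !mulr0 !addr0 (negPf u00).
  by rewrite pt01_notin_Uab.
right; pose k := - u0 / u1.
pose g r : PG F := pt 1 k (a * k ^+ 2 + b * k ^+ q.+1 + r).
have -> : Uab q a b :&: PG_line (vec3 u0 u1 0) = Yinf F |: g @: GFq q F.
  apply/setP => P; apply/setIP/setU1P => [[PU]|[->|/imsetP[r rq ->]]].
  - have PP := subsetP (Uab_PG a b) P PU; case/PG_pointP: PP PU => [x y|m|]; last by left.
      rewrite pt1_in_Uab pt1_in_line mulr0 addr0 addr_eq0 => xy /eqP E.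
      have xk : x = k by rewrite /k E opprK mulfK.
      right; apply/imsetP; exists (y - (a * x ^+ 2 + b * x ^+ q.+1)) => //.
      by rewrite /g -xk subrKC.
    by rewrite pt01_notin_Uab.
  - by rewrite Yinf_in_Uab Yinf_in_line.
  rewrite pt1_in_Uab pt1_in_line addrC addKr mulr0 addr0 addrC; split => //.
  by rewrite /k mulfVK // addNr.
have YS : Yinf F \notin g @: GFq q F by apply/imsetP => -[r _ /esym/pt1_neq_pt0].
rewrite cardsU1 YS card_imset ?(card_GFq hq hF) //.
by move=> r r' /pt1_inj[_ /addrI].
Qed.

End Uab.

(** * Sets of points and their equations *)

Section Forms.
Variables (q : nat) (F : finFieldType).
Hypotheses (hq : prime_power q) (hF : #|F| = (q ^ 2)%N).
Implicit Types (a b c d x y : F) (v w : 'rV[F]_3) (M A H : 'M[F]_3).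

Lemma ord3P (k : 'I_3) : [\/ k = 0, k = 1 | k = 2%:R].
Proof.
by case: k => [[|[|[|]]]] // ?; [apply: Or31|apply: Or32|apply: Or33]; apply: val_inj.
Qed.

Lemma sum3 (f : 'I_3 -> F) : \sum_(i < 3) f i = f 0 + f 1 + f 2%:R.
Proof.
rewrite !big_ord_recr big_ord0 /= add0r.
by congr (f _ + f _ + f _); apply: val_inj.
Qed.

Lemma eq_PG_points (V W : {set PG F}) :
    V \subset PG_points F -> W \subset PG_points F ->
  {in PG_points F, V =i W} -> V = W.
Proof.
move=> VP WP VW; apply/setP => P.
have [PP|PP] := boolP (P \in PG_points F); first exact: VW.
by rewrite (contraNF (subsetP VP P)) ?(contraNF (subsetP WP P)).
Qed.

Lemma eq_PG_sets (V W : {set PG F}) :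
    V \subset PG_points F -> W \subset PG_points F ->
    (forall v, v != 0 -> ((span1 v : PG F) \in V) = ((span1 v : PG F) \in W)) ->
  V = W.
Proof.
move=> VP WP VW; apply: eq_PG_points => // P /imsetP[v]; rewrite inE => v0 ->.
exact: VW.
Qed.

(** * Projectivities *)

Lemma projectivity_span1 M v : projectivity M (span1 v) = span1 (v *m M).
Proof.
apply/setP => w; apply/imsetP/imsetP => [[_ /imsetP[c _ ->] ->]|[c _ ->]].
  by exists c; rewrite ?scalemxAl.
by exists (c *: v); rewrite ?scalemxAl //; apply/imsetP; exists c.
Qed.

Lemma projectivityK M : M \in unitmx ->
  cancel (@projectivity F M) (@projectivity F (invmx M)).
Proof.
move=> uM P; rewrite /projectivity -imset_comp -[RHS]imset_id.
by apply: eq_imset => v /=; rewrite mulmxK.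
Qed.

Lemma projectivityVK M : M \in unitmx ->
  cancel (@projectivity F (invmx M)) (@projectivity F M).
Proof.
move=> uM P; have := @projectivityK (invmx M) _ P.
by rewrite unitmx_inv invmxK; apply.
Qed.

Lemma in_projectivity M (W : {set PG F}) v : M \in unitmx ->
  ((span1 v : PG F) \in projectivity M @: W) = ((span1 (v *m invmx M) : PG F) \in W).
Proof.
move=> uM; rewrite (can2_imset_pre _ (projectivityK uM) (projectivityVK uM)) inE.
by rewrite projectivity_span1.
Qed.

Lemma mulmx_unit_eq0 M v : M \in unitmx -> (v *m M == 0) = (v == 0).
Proof.
move=> uM; apply/eqP/eqP => [E|->]; last by rewrite mul0mx.
by rewrite -[v](mulmxK uM) E mul0mx.
Qed.

Lemma projectivity_PG M (W : {set PG F}) : M \in unitmx ->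
  W \subset PG_points F -> projectivity M @: W \subset PG_points F.
Proof.
move=> uM WP; apply/subsetP => _ /imsetP[P PW ->].
have /imsetP[v] := subsetP WP P PW; rewrite inE => v0 ->.
by rewrite projectivity_span1 span1_PG ?mulmx_unit_eq0.
Qed.

Lemma projectivity_PG_points M : M \in unitmx ->
  projectivity M @: PG_points F = PG_points F.
Proof.
move=> uM; apply: eq_PG_sets => // [|v v0]; first exact: projectivity_PG.
by rewrite in_projectivity // !span1_PG ?mulmx_unit_eq0 ?unitmx_inv.
Qed.

Lemma projectivity_PG_line M (u : 'rV[F]_3) : M \in unitmx ->
  projectivity M @: PG_line u = PG_line (u *m (invmx M)^T).
Proof.
move=> uM; apply: eq_PG_sets => [||v v0].
- by rewrite projectivity_PG // PG_line_sub.
- exact: PG_line_sub.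
rewrite in_projectivity // !span1_in_line ?mulmx_unit_eq0 ?unitmx_inv //.
by rewrite trmx_mul trmxK mulmxA.
Qed.

Lemma projectivity_iso M : M \in unitmx ->
  @isomorphism (PG F) (PG F) (projectivity M).
Proof.
move=> uM; split.
- exact: in2W (can_inj (projectivityK uM)).
- exact: projectivity_PG_points.
apply/setP => L; apply/imsetP/imsetP => [[_ /imsetP[u u0 ->] ->]|[u u0 ->]].
  exists (u *m (invmx M)^T); last by rewrite projectivity_PG_line.
  by move: u0; rewrite !inE mulmx_unit_eq0 // unitmx_tr unitmx_inv.
exists (PG_line (u *m M^T)).
  apply/imsetP; exists (u *m M^T) => //.
  by move: u0; rewrite !inE mulmx_unit_eq0 // unitmx_tr.
by rewrite projectivity_PG_line // -mulmxA -trmx_mul mulVmx // trmx1 mulmx1.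
Qed.

(** * Hermitian curves *)

Lemma conjmxM m n p (A : 'M[F]_(m, n)) (B : 'M[F]_(n, p)) :
  conjmx q (A *m B) = conjmx q A *m conjmx q B.
Proof.
apply/matrixP => i j; rewrite !mxE (big_morph _ (frobD hq hF) (frob0 _ hq)).
by apply: eq_bigr => k _; rewrite !mxE exprMn.
Qed.

Lemma conjmx_tr m n (A : 'M[F]_(m, n)) : conjmx q A^T = (conjmx q A)^T.
Proof. by apply/matrixP => i j; rewrite !mxE. Qed.

Lemma conjmxK m n (A : 'M[F]_(m, n)) : conjmx q (conjmx q A) = A.
Proof. by apply/matrixP => i j; rewrite !mxE frobK. Qed.

Lemma hermitian_curve_PG H : hermitian_curve q H \subset PG_points F.
Proof. by apply/subsetP => P; rewrite inE => /andP[]. Qed.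

Lemma in_hermitian_curve H v : v != 0 ->
  ((span1 v : PG F) \in hermitian_curve q H) = (v *m H *m (conjmx q v)^T == 0).
Proof.
move=> v0; rewrite inE span1_PG //=; apply/forall_inP/idP => [|/eqP vu w].
  by apply; exact: mem_span1.
case/imsetP => c _ ->.
have -> : conjmx q (c *: v) = c ^+ q *: conjmx q v.
  by apply/matrixP => i j; rewrite !mxE exprMn.
by rewrite linearZ /= -!scalemxAl -scalemxAr vu !scaler0.
Qed.

Lemma hermitian_form_vec3 H x0 x1 x2 :
  (vec3 x0 x1 x2 *m H *m (conjmx q (vec3 x0 x1 x2))^T) 0 0 =
    (x0 * H 0 0 + x1 * H 1 0 + x2 * H 2%:R 0) * x0 ^+ q
    + (x0 * H 0 1 + x1 * H 1 1 + x2 * H 2%:R 1) * x1 ^+ q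
    + (x0 * H 0 2%:R + x1 * H 1 2%:R + x2 * H 2%:R 2%:R) * x2 ^+ q.
Proof. by rewrite mxE sum3 !mxE !sum3 !mxE. Qed.

Lemma classical_projectivity M (V : {set PG F}) : M \in unitmx ->
  classical q V -> classical q (projectivity M @: V).
Proof.
move=> uM [H [HH uH ->]]; have uM' : invmx M \in unitmx by rewrite unitmx_inv.
exists (invmx M *m H *m (conjmx q (invmx M))^T); split.
- by rewrite !conjmxM !trmx_mul HH conjmx_tr conjmxK trmxK mulmxA.
- rewrite !unitmx_mul uM' uH unitmx_tr /=.
  case: (mulmx1_unit (A := conjmx q (invmx M)) (B := conjmx q M)) => //.
  rewrite -conjmxM mulVmx //; apply/matrixP => i j; rewrite !mxE.
  by case: (i == j); rewrite ?expr1n ?frob0.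
apply: eq_PG_sets => [||v v0].
- by rewrite projectivity_PG // hermitian_curve_PG.
- exact: hermitian_curve_PG.
rewrite in_projectivity // !in_hermitian_curve ?mulmx_unit_eq0 //.
by rewrite conjmxM trmx_mul !mulmxA.
Qed.

(** The matrix whose rows are listed in s. *)
Definition mx3 (s : seq (seq F)) : 'M[F]_3 := \matrix_(i < 3, j < 3) (nth [::] s i)`_j.

Lemma mx3_eq (A B : 'M[F]_3) :
  [/\ A 0 0 = B 0 0, A 0 1 = B 0 1 & A 0 2%:R = B 0 2%:R] ->
  [/\ A 1 0 = B 1 0, A 1 1 = B 1 1 & A 1 2%:R = B 1 2%:R] ->
  [/\ A 2%:R 0 = B 2%:R 0, A 2%:R 1 = B 2%:R 1 & A 2%:R 2%:R = B 2%:R 2%:R] ->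
  A = B.
Proof.
move=> [? ? ?] [? ? ?] [? ? ?]; apply/matrixP => i j.
by case: (ord3P i) => ->; case: (ord3P j) => ->.
Qed.

(** With e = b ^ q - b, the equation of U_b is e (y ^ q - y) = e ^ 2 x ^ (q+1),
which is Hermitian because e ^ q = - e. *)
Lemma Uab0_classical b : b \notin GFq q F -> classical q (Uab q 0 b).
Proof.
move=> bq; set e := b ^+ q - b.
have e0 : e != 0 by rewrite subr_eq0 -GFqE.
have eq : e ^+ q = - e by rewrite (frobB hq hF) (frobK hF) opprB.
have q0 : 0 ^+ q = 0 :> F := frob0 F hq.
pose H := mx3 [:: [:: 0; 0; e]; [:: 0; - e ^+ 2; 0]; [:: - e; 0; 0]].
have eq2 : (- e ^+ 2) ^+ q = - e ^+ 2.
  by rewrite frobN // exprAC eq sqrrN.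
exists H; split.
- apply: mx3_eq; split; rewrite !mxE /= ?q0 //.
  by rewrite frobN // eq opprK.
- pose H' := mx3 [:: [:: 0; 0; - e^-1]; [:: 0; - e ^- 2; 0]; [:: e^-1; 0; 0]].
  suff /mulmx1_unit[] : H *m H' = 1%:M by [].
  by apply: mx3_eq; split; rewrite !mxE sum3 !mxE /=; field.
apply: eq_PG_points => [||_ /PG_pointP[x y|m|]];
  [exact: Uab_PG | exact: hermitian_curve_PG | | |].
- rewrite pt1_in_Uab in_hermitian_curve ?vec3_eq0 ?oner_eq0 // mx11_eq0.
  rewrite hermitian_form_vec3 !mxE /= GFqE expr1n mul0r add0r.
  rewrite -subr_eq0 (frobB hq hF) exprMn (frob_norm hF).
  rewrite -(inj_eq (mulfI e0)) mulr0 exprS /e; congr (_ == 0). ring.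
- rewrite pt01_notin_Uab in_hermitian_curve ?vec3_eq0 ?oner_eq0 ?andbF // mx11_eq0.
  rewrite hermitian_form_vec3 !mxE /= expr1n q0.
  rewrite !(mulr0, mul0r, mul1r, mulr1, add0r, addr0).
  by rewrite oppr_eq0 expf_eq0 (negPf e0).
rewrite Yinf_in_Uab in_hermitian_curve ?vec3_eq0 ?oner_eq0 ?andbF // mx11_eq0.
rewrite hermitian_form_vec3 !mxE /= expr1n q0.
by rewrite !(mulr0, mul0r, mul1r, mulr1, add0r, addr0) eqxx.
Qed.

Lemma exists_GFq_nonidempotent : (2 < q)%N -> exists2 c, c \in GFq q F & c ^+ 2 != c.
Proof.
move=> q2; have /subsetPn[c cq] : ~~ (GFq q F \subset [set 0; 1]).
  apply/negP => /subset_leq_card; rewrite (card_GFq hq hF) cards2.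
  by rewrite eq_sym oner_eq0 leqNgt q2.
rewrite !inE negb_or => /andP[c0 c1]; exists c => //.
by rewrite -subr_eq0 expr2 -[X in _ - X]mulr1 -mulrBr mulf_neq0 // subr_eq0.
Qed.

(** For q = 2 the trace is the identity, and a ^ 3 / (b ^ 2 + b) ^ 2 is nonzero
when a <> 0 and b is not in GF(2): Ebert's condition fails. *)
Lemma ebert_q_gt2 a b : a != 0 -> ebert q a b -> (2 < q)%N.
Proof.
move=> a0 eab; rewrite ltnNge; apply/negP => q2.
have qE : q = 2%N by apply/eqP; rewrite eqn_leq q2 q_gt1.
move: eab; rewrite /ebert /trace2 qE /= big_ord1 /=.
case/andP=> bq; rewrite expr1 mulf_eq0 invr_eq0 !expf_eq0 (negPf a0) /=.
have ch2 := pchar2_even hq hF; rewrite qE in ch2.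
by rewrite addr_eq0 (oppr_pchar2 (ch2 isT)) -GFqE (negPf bq).
Qed.

(** Suppose that U_{a,b} is the Hermitian curve of H.  Comparing the points
r = 0 and r = 1 of each vertical line gives H 1 2 = 0, so that h = H 0 2 is
nonzero as H is invertible.  Scaling x by an element of GF(q) separates the
quadratic part h (a ^ q x ^ (2 q) - a x ^ 2) + k x ^ (q + 1) of the equation in
x from its linear part, so both vanish for every x.  The values of the
quadratic part at 1, b and b + 1 then force a = 0. *)
Lemma Uab_nonclassical a b :
  a != 0 -> b \notin GFq q F -> ebert q a b -> ~ classical q (Uab q a b).
Proof.
move=> a0 bq eab [H [HH uH UE]].
have frobD := frobD hq hF; have q0 := frob0 F hq.
have on_curve x r : r \in GFq q F -> let y := a * x ^+ 2 + b * x ^+ q.+1 + r in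
    H 0 0 + x * H 1 0 + y * H 2%:R 0 + (H 0 1 + x * H 1 1 + y * H 2%:R 1) * x ^+ q
    + (H 0 2%:R + x * H 1 2%:R + y * H 2%:R 2%:R) * y ^+ q = 0.
  move=> rq y; have : (pt 1 x y : PG F) \in Uab q a b.
    by rewrite pt1_in_Uab /y addrC addKr.
  rewrite UE in_hermitian_curve ?vec3_eq0 ?oner_eq0 // mx11_eq0.
  by rewrite hermitian_form_vec3 expr1n !mul1r mulr1 => /eqP.
have H22 : H 2%:R 2%:R = 0.
  have := Yinf_in_Uab q a b; rewrite UE in_hermitian_curve ?vec3_eq0 ?oner_eq0 ?andbF //.
  rewrite mx11_eq0 hermitian_form_vec3 expr1n q0.
  by rewrite !(mulr0, mul0r, mul1r, mulr1, add0r, addr0) => /eqP.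
have GF0 : 0 \in GFq q F by rewrite GFqE q0.
have GF1 : 1 \in GFq q F by rewrite GFqE expr1n.
(* the difference of the points r = 1 and r = 0 on a vertical line *)
have tang x : H 2%:R 0 + H 0 2%:R + (H 2%:R 1 * x ^+ q + H 1 2%:R * x) = 0.
  have := on_curve x 0 GF0; have := on_curve x 1 GF1.
  rewrite /= H22 addr0 frobD expr1n; set y := a * x ^+ 2 + b * x ^+ q.+1.
  move=> E1 E0; have := congr2 (fun s t => s - t) E1 E0.
  by rewrite /= [0 - 0]subrr => <-; ring.
have H20 : H 2%:R 0 = - H 0 2%:R.
  by apply/eqP; rewrite -addr_eq0; have := tang 0; rewrite q0 !mulr0 !addr0 => ->.
have tang' x : H 2%:R 1 * x ^+ q = - (H 1 2%:R * x).
  by apply/eqP; rewrite -addr_eq0; have := tang x; rewrite H20 addNr add0r => ->.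
have H21 : H 2%:R 1 = - H 1 2%:R by have := tang' 1; rewrite expr1n !mulr1.
have H12 : H 1 2%:R = 0.
  apply/eqP; move: (tang' b) => /eqP; rewrite H21 mulNr eqr_opp.
  rewrite -subr_eq0 -mulrBr mulf_eq0 subr_eq0 -GFqE (negPf bq) orbF //.
rewrite H12 oppr0 in H21.
set h := H 0 2%:R in H20 *.
have h0 : h != 0.
  apply/eqP => h0; have : H *m (vec3 0 0 1)^T = 0.
    apply/colP => i; rewrite !mxE sum3 !mxE /= !(mulr0, add0r, mulr1).
    by case: (ord3P i) => ->.
  move/(congr1 (mulmx (invmx H))); rewrite mulKmx // mulmx0.
  move/(congr1 trmx)/eqP; rewrite trmxK trmx0 vec3_eq0 oner_eq0 !andbF //.
have curve x : H 0 0 + (x * H 1 0 + H 0 1 * x ^+ q)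
    + ((H 1 1 + h * (b ^+ q - b)) * (x * x ^+ q)
       + h * (a ^+ q * (x ^+ q) ^+ 2 - a * x ^+ 2)) = 0.
  have := on_curve x 0 GF0; rewrite /= H20 H21 H12 H22 addr0 frobD !exprMn.
  rewrite (frob_norm hF) [x ^+ q.+1]exprS -/h => <-; ring.
have H00 : H 0 0 = 0.
  by have := curve 0; rewrite q0 expr0n /= !(mulr0, mul0r, subr0, addr0).
have [c cq c2] := exists_GFq_nonidempotent (ebert_q_gt2 a0 eab).
have quad x : (H 1 1 + h * (b ^+ q - b)) * (x * x ^+ q)
       + h * (a ^+ q * (x ^+ q) ^+ 2 - a * x ^+ 2) = 0.
  have := curve x; have := curve (c * x); rewrite H00 !exprMn.
  rewrite (eqP (_ : c ^+ q == c)) -?GFqE //.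
  set Q := _ + h * (a ^+ q * (x ^+ q) ^+ 2 - _) => E1 E2.
  have c2' : c ^+ 2 - c != 0 by rewrite subr_eq0.
  apply: (mulfI c2'); rewrite mulr0.
  (* the equation at c x minus c times the equation at x *)
  have := congr2 (fun s t => s - c * t) E1 E2.
  by rewrite /= mulr0 [0 - 0]subrr => <-; rewrite /Q; ring.
have fact x : (x ^+ q - x) * (a * x + a ^+ q * x ^+ q) = 0.
  have := quad 1; rewrite expr1n expr1n mulr1 mulr1 mulr1 mulr1 => /eqP.
  rewrite addr_eq0 => /eqP E; have := quad x; rewrite E => E'.
  by apply: (mulfI h0); rewrite mulr0 -E'; ring.
have trace0 x : x \notin GFq q F -> a * x + a ^+ q * x ^+ q = 0.
  rewrite GFqE -subr_eq0 => xq; apply/eqP; have /eqP := fact x.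
  by rewrite mulf_eq0 (negPf xq).
have b1q : b + 1 \notin GFq q F.
  by rewrite GFqE frobD expr1n (inj_eq (addIr 1)) -GFqE.
have Eb := trace0 b bq; have := trace0 _ b1q; rewrite frobD expr1n.
rewrite (_ : _ + _ = (a * b + a ^+ q * b ^+ q) + (a + a ^+ q)); last by ring.
rewrite Eb add0r => /eqP; rewrite addrC addr_eq0 => /eqP Ea.
move: Eb; rewrite Ea => /eqP.
rewrite mulNr -mulrBr mulf_eq0 (negPf a0) subr_eq0 eq_sym -GFqE (negPf bq) //.
Qed.

(** * Unions of conics *)

(** The zero set of the quadratic form with matrix A. *)
Definition conic_set A : {set PG F} :=
  [set P in PG_points F | [forall v in (P : {set 'rV[F]_3}), v *m A *m v^T == 0]].

Lemma conic_set_PG A : conic_set A \subset PG_points F.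
Proof. by apply/subsetP => P; rewrite inE => /andP[]. Qed.

Lemma in_conic_set A v : v != 0 ->
  ((span1 v : PG F) \in conic_set A) = (v *m A *m v^T == 0).
Proof.
move=> v0; rewrite inE span1_PG //=; apply/forall_inP/idP => [|/eqP vu w].
  by apply; exact: mem_span1.
by case/imsetP => c _ ->; rewrite linearZ /= -!scalemxAl -scalemxAr vu !scaler0.
Qed.

Lemma conic_projectivity M (C : {set PG F}) : M \in unitmx ->
  conic C -> conic (projectivity M @: C).
Proof.
move=> uM [A [AA uA ->]]; have uM' : invmx M \in unitmx by rewrite unitmx_inv.
exists (invmx M *m A *m (invmx M)^T); split.
- by rewrite !trmx_mul AA trmxK mulmxA.
- by rewrite !unitmx_mul uM' uA unitmx_tr.
apply: eq_PG_sets => [||v v0].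
- by rewrite projectivity_PG // conic_set_PG.
- exact: conic_set_PG.
rewrite in_projectivity // !in_conic_set ?mulmx_unit_eq0 //.
by rewrite trmx_mul !mulmxA.
Qed.

(** The conic x0 x2 = a x1 ^ 2 + r x0 ^ 2; its equation is doubled so that the
matrix is symmetric. *)
Definition parabola_conic a r : {set PG F} :=
  conic_set (mx3 [:: [:: - (r *+ 2); 0; 1]; [:: 0; - (a *+ 2); 0]; [:: 1; 0; 0]]).

Lemma parabola_conicP a r : 2%:R != 0 :> F -> a != 0 -> conic (parabola_conic a r).
Proof.
move=> F2 a0;
set A := mx3 [:: [:: - (r *+ 2); 0; 1]; [:: 0; - (a *+ 2); 0]; [:: 1; 0; 0]].
exists A; split=> //; first by apply: mx3_eq; split; rewrite !mxE.
pose A' := mx3 [:: [:: 0; 0; 1]; [:: 0; - (a *+ 2)^-1; 0]; [:: 1; 0; r *+ 2]].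
suff /mulmx1_unit[] : A *m A' = 1%:M by [].
by apply: mx3_eq; split; rewrite !mxE sum3 !mxE /=; field; rewrite ?F2 ?a0.
Qed.

Lemma pt1_in_parabola_conic a r x y : 2%:R != 0 :> F ->
  ((pt 1 x y : PG F) \in parabola_conic a r) = (y == a * x ^+ 2 + r).
Proof.
move=> F2; rewrite in_conic_set ?vec3_eq0 ?oner_eq0 // mx11_eq0.
rewrite mxE sum3 !mxE !sum3 !mxE /= -(subr_eq0 y).
rewrite -[RHS](inj_eq (mulfI F2)) [2%:R * 0]mulr0.
by congr (_ == 0); ring.
Qed.

Lemma pt01_in_parabola_conic a r x : 2%:R != 0 :> F -> a != 0 ->
  ((pt 0 1 x : PG F) \in parabola_conic a r) = false.
Proof.
move=> F2 a0; rewrite in_conic_set ?vec3_eq0 ?oner_eq0 ?andbF // mx11_eq0.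
rewrite mxE sum3 !mxE !sum3 !mxE /=.
rewrite (_ : _ + _ = - (a * 2%:R)); last by ring.
by rewrite oppr_eq0 mulf_eq0 (negPf a0) (negPf F2).
Qed.

Lemma Yinf_in_parabola_conic a r : Yinf F \in parabola_conic a r.
Proof.
rewrite in_conic_set ?vec3_eq0 ?oner_eq0 ?andbF // mx11_eq0.
rewrite mxE sum3 !mxE !sum3 !mxE /=.
by rewrite !(mulr0, mul0r, mul1r, mulr1, add0r, addr0).
Qed.

(** For b in GF(q) the term b x ^ (q + 1) is absorbed by r, so that U_{a,b} is
the union of the conics y = a x ^ 2 + r with r in GF(q). *)
Lemma Uab_HSz a b M : M \in unitmx -> ebert q a b -> b \in GFq q F ->
  HSz_type q (projectivity M @: Uab q a b).
Proof.
move=> uM eab bq; have oq : odd q.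
  by move: eab; rewrite /ebert; case: ifP => // _; rewrite bq.
have F2 : 2%:R != 0 :> F := two_neq0_odd hq hF oq.
have q0 := frob0 F hq.
have a0 : a != 0.
  apply/eqP => a0; move: eab; rewrite /ebert oq a0 => /forall_inP/(_ 0).
  rewrite GFqE q0 eqxx => /(_ isT).
  move: bq; rewrite GFqE => /eqP->.
  by rewrite [0 ^+ q.+1]exprS mul0r mulr0 subrr add0r eqxx.
split=> //; exists [set projectivity M @: parabola_conic a r | r in GFq q F].
exists (projectivity M (Yinf F)); split.
- rewrite card_in_imset ?(card_GFq hq hF) // => r r' _ _.
  move/(imset_inj (can_inj (projectivityK uM))) => E.
  have : (pt 1 0 r : PG F) \in parabola_conic a r.
    by rewrite pt1_in_parabola_conic // expr0n mulr0 add0r.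
  by rewrite E pt1_in_parabola_conic // expr0n mulr0 add0r => /eqP.
- move=> _ /imsetP[r _ ->]; split; first exact/conic_projectivity/parabola_conicP.
  exact/imset_f/Yinf_in_parabola_conic.
have UP : forall P : PG F,
    (P \in Uab q a b) = [exists r in GFq q F, P \in parabola_conic a r].
  move=> P; have [PP|PP] := boolP (P \in PG_points F); last first.
    rewrite (contraNF (subsetP (Uab_PG q a b) P)) //; apply/esym/exists_inP.
    move=> [r _ rP].
    by have := subsetP (conic_set_PG _) P rP; rewrite (negPf PP).
  case/PG_pointP: PP => [x y|m|].
  - have bN : b * x ^+ q.+1 \in GFq q F by rewrite GFqM // norm_GFq.
    rewrite pt1_in_Uab; apply/idP/exists_inP => [yq|[r rq]].
      exists (y - a * x ^+ 2); last by rewrite pt1_in_parabola_conic // subrKC.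
      rewrite (_ : _ - _ = y - (a * x ^+ 2 + b * x ^+ q.+1) + b * x ^+ q.+1).
        exact: GFqD.
      by ring.
    rewrite pt1_in_parabola_conic // => /eqP->.
    rewrite (_ : _ - _ = r + - (b * x ^+ q.+1)); last by ring.
    by rewrite GFqD // GFqN.
  - rewrite pt01_notin_Uab; apply/esym/exists_inP => -[r _].
    by rewrite pt01_in_parabola_conic.
  rewrite Yinf_in_Uab; apply/esym/exists_inP; exists 0; first by rewrite GFqE q0.
  exact: Yinf_in_parabola_conic.
apply/setP => P; apply/imsetP/bigcupP => [[R]|[_ /imsetP[r rq ->] /imsetP[R RC ->]]].
  rewrite UP => /exists_inP[r rq RC] ->.
  by exists (projectivity M @: parabola_conic a r); rewrite imset_f.
by exists R => //; rewrite UP; apply/exists_inP; exists r.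
Qed.

End Forms.

(** * The projective closure of the plane of parabolas *)

Section Closure.
Variables (F : finFieldType) (a : F).
Implicit Types (k m d x y : F) (z : F * F).

Local Notation G := (Aplane a).
Local Notation PC := (projective_closure (Aplane a)).

Lemma vline_neq_parabola k m d : vline k <> parabola a m d.
Proof.
move/setP/(_ (k, a * k ^+ 2 + m * k + d + 1)); rewrite !inE /= eqxx => /esym/eqP.
by move/eqP; rewrite addrC -subr_eq0 addrK oner_eq0.
Qed.

Lemma parallel_class_vline k :
  @parallel_class G (vline k) = [set (vline k' : {set G}) | k' : F].
Proof.
apply/setP => M; rewrite inE; apply/andP/imsetP => [[]|[k' _ ->]].
  case/setUP => /imsetP; first by move=> [k' _ ->] _; exists k'.
  move=> [[m d] _ ->] /orP[/eqP/esym/vline_neq_parabola//|].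
  rewrite -setI_eq0 => /eqP/setP/(_ (k, a * k ^+ 2 + m * k + d)).
  by rewrite !inE /= !eqxx.
split; first by apply/setUP; left; apply: imset_f.
have [->|kk'] := eqVneq k' k; first by rewrite eqxx.
rewrite -setI_eq0; apply/orP; right; apply/eqP/setP => z; rewrite !inE.
by apply/negP => /andP[/eqP-> /eqP]; apply/eqP.
Qed.

Lemma parallel_class_parabola m d :
  @parallel_class G (parabola a m d) = [set (parabola a m d' : {set G}) | d' : F].
Proof.
apply/setP => M; rewrite inE; apply/andP/imsetP => [[]|[d' _ ->]].
  case/setUP => /imsetP.
    move=> [k _ ->] /orP[/eqP/vline_neq_parabola//|].
    rewrite -setI_eq0 => /eqP/setP/(_ (k, a * k ^+ 2 + m * k + d)).
    by rewrite !inE /= !eqxx.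
  move=> [[m' d'] _ ->] /= dis; exists d' => //; congr parabola.
  apply/eqP; apply/negPn/negP => mm'.
  case/orP: dis => [/eqP/setP E|].
    have := E (0, d'); have := E (1, a + m' + d').
    rewrite !inE /= !(expr0n, expr1n, mulr0, mulr1, add0r, eqxx) => /esym/eqP E1.
    move/esym/eqP => E0; move: E1 mm'; rewrite E0 => /addIr/addrI->.
    by rewrite eqxx.
  (* the parabolas of slopes m and m' meet over x = (d' - d) / (m - m') *)
  pose x := (d' - d) / (m - m').
  rewrite -setI_eq0 => /eqP/setP/(_ (x, a * x ^+ 2 + m * x + d)).
  rewrite !inE /= eqxx andbT => /eqP; apply; rewrite /x.
  by field; rewrite subr_eq0 eq_sym.
split; first by apply/setUP; right; apply/imsetP; exists (m, d').
have [->|dd'] := eqVneq d' d; first by rewrite eqxx.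
rewrite -setI_eq0; apply/orP; right; apply/eqP/setP => z; rewrite !inE.
by apply/negP => /andP[/eqP-> /eqP/addrI/eqP]; apply/negP.
Qed.

Lemma vclassE k : vclass a = @parallel_class G (vline k).
Proof. by rewrite /vclass !parallel_class_vline. Qed.

Lemma pclassE m d : pclass a m = @parallel_class G (parabola a m d).
Proof. by rewrite /pclass !parallel_class_parabola. Qed.

Lemma pclass_inj : injective (pclass a).
Proof.
move=> m m' E; have : (parabola a m 0 : {set G}) \in pclass a m.
  by rewrite /pclass parallel_class_parabola imset_f.
rewrite E /pclass parallel_class_parabola => /imsetP[d _ /setP E'].
have := E' (0, 0); have := E' (1, a + m); rewrite !inE /=.
rewrite !(expr0n, expr1n, mulr0, mulr1, add0r, addr0, eqxx) => /esym/eqP E1.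
by move/esym/eqP => d0; move: E1; rewrite -d0 addr0 => /addrI.
Qed.

Lemma vclass_neq_pclass m : vclass a <> pclass a m.
Proof.
move=> E; have : (vline 0 : {set G}) \in vclass a.
  by rewrite /vclass parallel_class_vline imset_f.
by rewrite E /pclass parallel_class_parabola => /imsetP[d _ /vline_neq_parabola].
Qed.

(** The points of the closure: affine ones, and the infinite points of the
vertical lines and of the parabolas of each slope. *)
Variant closure_point_spec : PC -> Prop :=
  | Caffine z : closure_point_spec (inl z)
  | Cvertical : closure_point_spec (inr (vclass a))
  | Cslope m : closure_point_spec (inr (pclass a m)).

Lemma classP (c : {set {set G}}) :
  c \in [set parallel_class L | L : {set G} in lines G] ->
  c = vclass a \/ exists m, c = pclass a m.
Proof.
case/imsetP => L /setUP[] /imsetP[]; first by move=> k _ -> ->; left; rewrite (vclassE k).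
by move=> [m d] _ -> ->; right; exists m; rewrite (pclassE m d).
Qed.

Lemma vclass_class : vclass a \in [set parallel_class L | L : {set G} in lines G].
Proof. by apply/imset_f/setUP; left; apply/imsetP; exists 0. Qed.

Lemma pclass_class m : pclass a m \in [set parallel_class L | L : {set G} in lines G].
Proof. by apply/imset_f/setUP; right; apply/imsetP; exists (m, 0). Qed.

Lemma closure_pointP (P : PC) : P \in points PC -> closure_point_spec P.
Proof.
case/setUP => /imsetP[]; first by move=> z _ ->; constructor.
by move=> c /classP[->|[m ->]] ->; constructor.
Qed.

Lemma affine_point z : (inl z : PC) \in points PC.
Proof. by apply/setUP; left; apply/imset_f; rewrite inE. Qed.

Lemma vertical_point : (inr (vclass a) : PC) \in points PC.
Proof. by apply/setUP; right; apply/imset_f/vclass_class. Qed.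

Lemma slope_point m : (inr (pclass a m) : PC) \in points PC.
Proof. by apply/setUP; right; apply/imset_f/pclass_class. Qed.

Local Notation coord := (@coordinates F a).

Lemma coordinates_affine z : coord (inl z) = pt 1 z.1 (z.2 - a * z.1 ^+ 2).
Proof. by []. Qed.

Lemma coordinates_vertical : coord (inr (vclass a)) = pt 0 0 1.
Proof. by rewrite /coordinates; case: pickP => // m /eqP/vclass_neq_pclass. Qed.

Lemma coordinates_slope m : coord (inr (pclass a m)) = pt 0 1 m.
Proof.
rewrite /coordinates; case: pickP => [m' /eqP/pclass_inj->//|/(_ m)].
by rewrite eqxx.
Qed.

Definition coordinatesE :=
  (coordinates_affine, coordinates_vertical, coordinates_slope).

Lemma coordinates_inj : {in points PC &, injective coord}.
Proof.
move=> P Q /closure_pointP[z||m] /closure_pointP[z'||m']; rewrite !coordinatesE //.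
- by case/pt1_inj; case: z z' => [x y] [x' y'] /= -> /addIr->.
- by move/pt1_neq_pt0.
- by move/pt1_neq_pt0.
- by move/esym/pt1_neq_pt0.
- by move/esym/pt01_neq_Yinf.
- by move/esym/pt1_neq_pt0.
- by move/pt01_neq_Yinf.
by move/pt01_inj->.
Qed.

Lemma coordinates_points : coord @: points PC = points (PG F).
Proof.
apply/setP => P; apply/imsetP/idP => [[_ /closure_pointP[z||m] ->]|].
- exact: pt1_PG.
- by rewrite coordinates_vertical; exact: Yinf_PG.
- by rewrite coordinates_slope; exact: pt01_PG.
case/PG_pointP => [x y|m|].
- by exists (inl (x, y + a * x ^+ 2)); rewrite ?affine_point // coordinatesE /= addrK.
- by exists (inr (pclass a m)); rewrite ?slope_point // coordinatesE.
by exists (inr (vclass a)); rewrite ?vertical_point // coordinatesE.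
Qed.

(** Since the coordinates map the points onto those of PG(2, F), an image is
determined by a membership test point by point. *)
Lemma coordinates_imset (L : {set PC}) (W : {set PG F}) :
    L \subset points PC -> W \subset PG_points F ->
    (forall P, P \in points PC -> (coord P \in W) = (P \in L)) ->
  coord @: L = W.
Proof.
move=> LP WP LW; apply/setP => Q; apply/imsetP/idP => [[P PL ->]|QW].
  by rewrite LW // (subsetP LP).
have : Q \in coord @: points PC by rewrite coordinates_points (subsetP WP).
by case/imsetP => P PP QE; exists P; rewrite // -LW -?QE.
Qed.

Lemma in_inl (z : F * F) (A : {set F * F}) c :
  ((inl z : PC) \in (inr c : PC) |: [set (inl w : PC) | w in A]) = (z \in A).
Proof. by rewrite !inE /= mem_imset //; apply: inl_inj. Qed.

Lemma in_inr (c c' : {set {set G}}) (A : {set F * F}) :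
  ((inr c : PC) \in (inr c' : PC) |: [set (inl w : PC) | w in A]) = (c == c').
Proof.
rewrite in_setU1; case: imsetP => [[]//|_]; rewrite orbF.
by apply/eqP/eqP => [[]|->].
Qed.

Lemma closure_line_sub (L : {set PC}) : L \in lines PC -> L \subset points PC.
Proof.
case/setUP => [/set1P->|/imsetP[M ML ->]]; apply/subsetP => P.
  by case/imsetP => c cC ->; apply/setUP; right; apply: imset_f.
case/setU1P => [->|/imsetP[z _ ->]]; last exact: affine_point.
by apply/setUP; right; do 2!apply: imset_f.
Qed.

(** * Lines of the closure *)

(** The set of all points at infinity. *)
Definition infinite_line : {set PC} :=
  inr @: [set parallel_class L | L : {set G} in lines G].

(** A line L of the affine plane together with its point at infinity. *)
Definition closed_line (L : {set G}) : {set PC} :=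
  inr (parallel_class L) |: inl @: L.

Lemma infinite_line_in : infinite_line \in lines PC.
Proof. by apply/setUP; left; rewrite inE. Qed.

Lemma closed_line_in (L : {set G}) : L \in lines G -> closed_line L \in lines PC.
Proof. by move=> LG; apply/setUP; right; apply/imsetP; exists L. Qed.

Lemma vline_in k : (vline k : {set G}) \in lines G.
Proof. by apply/setUP; left; apply: imset_f. Qed.

Lemma parabola_in m d : (parabola a m d : {set G}) \in lines G.
Proof. by apply/setUP; right; apply/imsetP; exists (m, d). Qed.

Lemma coordinates_infinite_line : coord @: infinite_line = PG_line (vec3 1 0 0).
Proof.
apply: coordinates_imset => [||P /closure_pointP[z||m]].
- exact: closure_line_sub infinite_line_in.
- exact: PG_line_sub.
- rewrite coordinatesE pt1_in_line !mulr0 !addr0 oner_eq0.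
  by apply/esym/imsetP => -[].
- by rewrite coordinatesE Yinf_in_line eqxx imset_f // vclass_class.
by rewrite coordinatesE pt01_in_line mulr0 addr0 eqxx imset_f // pclass_class.
Qed.

Lemma coordinates_vline k :
  coord @: closed_line (vline k) = PG_line (vec3 (- k) 1 0).
Proof.
apply: coordinates_imset => [||P /closure_pointP[z||m]].
- exact/closure_line_sub/closed_line_in/vline_in.
- exact: PG_line_sub.
- rewrite coordinatesE pt1_in_line in_inl inE mulr1 mulr0 addr0 addrC.
  by rewrite subr_eq0.
- by rewrite coordinatesE Yinf_in_line in_inr -vclassE !eqxx.
rewrite coordinatesE pt01_in_line in_inr -vclassE mulr0 addr0 oner_eq0.
by apply/esym/eqP => /esym/vclass_neq_pclass.
Qed.

Lemma coordinates_parabola m d :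
  coord @: closed_line (parabola a m d) = PG_line (vec3 (- d) (- m) 1).
Proof.
apply: coordinates_imset => [||P /closure_pointP[z||m']].
- exact/closure_line_sub/closed_line_in/parabola_in.
- exact: PG_line_sub.
- rewrite coordinatesE pt1_in_line in_inl inE -[RHS]subr_eq0.
  by congr (_ == 0); ring.
- rewrite coordinatesE Yinf_in_line in_inr -pclassE oner_eq0.
  by apply/esym/eqP/vclass_neq_pclass.
rewrite coordinatesE pt01_in_line in_inr -pclassE mulr1 addrC subr_eq0.
by rewrite (inj_eq pclass_inj).
Qed.

Lemma PG_lineZ c (u : 'rV[F]_3) : c != 0 -> PG_line (c *: u) = PG_line u.
Proof.
move=> c0; apply: eq_PG_sets => [||v v0]; try exact: PG_line_sub.
by rewrite !span1_in_line // linearZ /= -scalemxAr scalemx_eq0 (negPf c0).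
Qed.

Lemma coordinates_lines :
  [set coord @: L | L : {set PC} in lines PC] = lines (PG F).
Proof.
apply/setP => L; apply/imsetP/imsetP => [[M]|[u]].
  case/setUP => [/set1P-> ->|/imsetP[N /setUP[]]].
  - exists (vec3 1 0 0); last exact: coordinates_infinite_line.
    by rewrite inE vec3_eq0 oner_eq0.
  - case/imsetP => k _ -> -> ->; exists (vec3 (- k) 1 0); last exact: coordinates_vline.
    by rewrite inE vec3_eq0 oner_eq0 !andbF.
  case/imsetP => -[m d] _ -> -> ->.
  exists (vec3 (- d) (- m) 1); last exact: coordinates_parabola.
  by rewrite inE vec3_eq0 oner_eq0 !andbF.
rewrite inE; have [u0 [u1 [u2 ->]]] := vec3P u => un0 ->.
have [u20|u2n] := eqVneq u2 0; last first.
  exists (closed_line (parabola a (- (u1 / u2)) (- (u0 / u2)))).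
    exact/closed_line_in/parabola_in.
  rewrite coordinates_parabola !opprK -[RHS](PG_lineZ _ u2n) vec3Z.
  by rewrite mulr1 ![u2 * _]mulrC !mulfVK.
have [u10|u1n] := eqVneq u1 0; last first.
  exists (closed_line (vline (- (u0 / u1)))).
    exact/closed_line_in/vline_in.
  rewrite coordinates_vline opprK -[RHS](PG_lineZ _ u1n) vec3Z u20.
  by rewrite mulr1 mulr0 ![u1 * _]mulrC !mulfVK.
have u0n : u0 != 0 by move: un0; rewrite vec3_eq0 u10 u20 eqxx !andbT.
exists infinite_line; first exact: infinite_line_in.
by rewrite coordinates_infinite_line -[RHS](PG_lineZ _ u0n) vec3Z u10 u20 mulr1 mulr0.
Qed.

Lemma coordinates_iso : isomorphism coord.
Proof.
by split; [exact: coordinates_inj | exact: coordinates_points | exact: coordinates_lines].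
Qed.

(** Over the affine point (x, y) the second coordinate drops by a x ^ 2, which
turns b x ^ (q + 1) + r into - a x ^ 2 + b x ^ (q + 1) + r. *)
Lemma coordinates_in_closure q b :
  coord @: in_closure a (Uab q 0 b) = Uab q (- a) b.
Proof.
have mem_in_closure P : P \in points PC ->
    (P \in in_closure a (Uab q 0 b)) =
      match P with
      | inl z => (pt 1 z.1 z.2 : PG F) \in Uab q 0 b
      | inr c => (c == vclass a) && (Yinf F \in Uab q 0 b)
      end by move=> PP; rewrite inE PP.
apply: coordinates_imset => [||P PP]; [|exact: Uab_PG|].
  by apply/subsetP => P; rewrite inE => /andP[].
rewrite mem_in_closure //; case/closure_pointP: PP => [z||m].
- rewrite coordinatesE !pt1_in_Uab; congr (_ \in GFq q F); ring.
- by rewrite coordinatesE Yinf_in_Uab eqxx (Yinf_in_Uab q 0 b : Yinf F \in Uab q 0 b).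
rewrite coordinatesE pt01_notin_Uab; apply/esym/negbTE.
by rewrite negb_and; apply/orP; left; apply/eqP => /esym/vclass_neq_pclass.
Qed.

End Closure.

(** * Transfer of the unitals *)

Lemma isomorphism_comp (G H K : geometry) (f : G -> H) (g : H -> K) :
  isomorphism f -> isomorphism g -> isomorphism (g \o f).
Proof.
move=> [fi fp fl] [gi gp gl]; split.
- move=> x y xG yG /gi E; apply: fi => //; apply: E.
    by rewrite -fp imset_f.
  by rewrite -fp imset_f.
- by rewrite imset_comp fp gp.
rewrite -gl -fl -imset_comp; apply: eq_imset => L /=.
by rewrite imset_comp.
Qed.

Lemma Ub_Uab q (F : finFieldType) (b : F) : Ub q b = Uab q 0 b.
Proof.
rewrite /Ub /Uab; congr (_ |: _); apply: eq_in_imset2 => x r _ _.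
by rewrite mul0r add0r.
Qed.

Section Main.
Variables (q : nat) (F : finFieldType).
Hypotheses (hq : prime_power q) (hF : #|F| = (q ^ 2)%N).
Implicit Types a b : F.

Lemma ebertN a b : ebert q (- a) b = ebert q a b.
Proof.
suff aN : (- a) ^+ q.+1 = a ^+ q.+1 by rewrite /ebert aN.
by rewrite exprS (frobN hq hF) mulrNN -exprS.
Qed.

Lemma ebert0 b : b \notin GFq q F -> ebert q 0 b.
Proof.
move=> bq; rewrite /ebert; case: ifP => [oq|_].
  apply/forall_inP => s sq; rewrite [0 ^+ q.+1]exprS mul0r mulr0 add0r.
  apply: contra bq; rewrite eqf_sqr => s2.
  have eq : b ^+ q - b \in GFq q F.
    by case/orP: s2 => /eqP E; rewrite -?E // -GFqN // -E.
  (* e = b ^ q - b satisfies e ^ q = - e *)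
  move: eq; rewrite !GFqE (frobB hq hF) (frobK hF) -subr_eq0.
  rewrite (_ : _ - _ = - (2%:R * (b ^+ q - b))); last by ring.
  by rewrite oppr_eq0 mulf_eq0 (negPf (two_neq0_odd hq hF oq)) subr_eq0.
rewrite bq [0 ^+ q.+1]exprS mul0r mul0r /trace2 big1 ?eqxx // => i _.
by rewrite expr0n expn_eq0.
Qed.

End Main.

Theorem theorem3p4 (q : nat) (F : finFieldType)
    (hq : prime_power q) (hF : #|F| = (q ^ 2)%N) :
  (forall a b : F, a != 0 -> b \notin GFq q F ->
     (unital q (Ub q b) /\ classical q (Ub q b)) /\
     (ebert q a b ->
        [/\ isomorphism (@coordinates F a),
            @coordinates F a @: in_closure a (Ub q b) = Uab q (- a) b,
            BM_unital q (Uab q (- a) b) &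
            ~ classical q (Uab q (- a) b)])) /\
  (forall V : {set PG F},
     BM_unital q V -> ~ classical q V -> ~ HSz_type q V ->
     exists a b : F,
       [/\ a != 0, b \notin GFq q F, ebert q a b &
           exists f : projective_closure (Aplane a) -> PG F,
             isomorphism f /\ f @: in_closure a (Ub q b) = V]).
Proof.
split=> [a b a0 bq|V [_ [a [b [eab [M uM ->]]]]] ncl nHSz].
  rewrite Ub_Uab; split.
    by split; [exact/Uab_unital/ebert0 | exact: Uab0_classical].
  move=> eab; have eNab : ebert q (- a) b by rewrite ebertN.
  split.
  - exact: coordinates_iso.
  - exact: coordinates_in_closure.
  - split; first exact: Uab_unital.
    exists (- a), b; split=> //; exists 1%:M; first exact: unitmx1.
    rewrite -[LHS]imset_id; apply: eq_imset => P.
    rewrite /projectivity -[LHS]imset_id; apply: eq_imset => v /=.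
    by rewrite mulmx1.
  by apply: Uab_nonclassical => //; rewrite oppr_eq0.
have bq : b \notin GFq q F by apply/negP => bq; apply: nHSz; exact: Uab_HSz.
have a0 : a != 0.
  apply/eqP => a0; apply: ncl; apply: classical_projectivity => //.
  by rewrite a0; exact: Uab0_classical.
exists (- a), b; split=> //; rewrite ?oppr_eq0 ?ebertN //.
exists (@projectivity F M \o @coordinates F (- a)); split.
  exact: isomorphism_comp (coordinates_iso _) (projectivity_iso uM).
by rewrite imset_comp Ub_Uab coordinates_in_closure opprK.
Qed.
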